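(* Let $n$ be any positive integer and let $\lambda$ be a partition with $n$ or fewer parts. Then the set $\mathrm{GTP}(n,\lambda)$ of all Gelfand-Tsetlin patterns with $n$ rows and top row $\lambda$, equipped with the maps $\mathrm{wt}$, $\widetilde f_i$, $\widetilde e_i$, $\varphi_i$, $\varepsilon_i$ ($i\in\{1,\dots,n-1\}$) defined in the context, is a crystal of type $A_{n-1}$. (In particular, $\widetilde f_i$ and $\widetilde e_i$ take values in $\mathrm{GTP}(n,\lambda)\sqcup\{0\}$, as the definition of a crystal requires.)
   Context: **Cartan datum of type $A_{n-1}$.** The index set is $I=\{1,2,\dots,n-1\}$. The weight lattice $P$ is the abelian group generated by $\boldsymbol e_1,\dots,\boldsymbol e_n$ subject to the relation $\boldsymbol e_1+\cdots+\boldsymbol e_n=0$. For $i\in I$, $\alpha_i=\boldsymbol e_i-\boldsymbol e_{i+1}\in P$, and $\alpha_j^\vee\in\mathrm{Hom}_{\mathbb Z}(P,\mathbb Z)$ is given by $\langle \boldsymbol e_i,\alpha_j^\vee\rangle=\delta_{ij}-\delta_{i,j+1}$. **Crystal.** A crystal of type $A_{n-1}$ is a non-empty set $\mathcal B$ together with maps $\mathrm{wt}:\mathcal B\to P$, $\widetilde e_i,\widetilde f_i:\mathcal B\to\mathcal B\sqcup\{0\}$ and $\varepsilon_i,\varphi_i:\mathcal B\to\mathbb Z\sqcup\{-\infty\}$ ($i\in I$) such that for all $b,b'\in\mathcal B$ and $i\in I$: (i) $\widetilde f_i(b)=b'$ if and only if $b=\widetilde e_i(b')$, in which case $\mathrm{wt}(b')=\mathrm{wt}(b)-\alpha_i$,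 $\varepsilon_i(b')=\varepsilon_i(b)+1$, $\varphi_i(b')=\varphi_i(b)-1$; (ii) $\varphi_i(b)=\varepsilon_i(b)+\langle\mathrm{wt}(b),\alpha_i^\vee\rangle$ (in particular $\varphi_i(b)=-\infty$ iff $\varepsilon_i(b)=-\infty$); (iii) if $\varphi_i(b)=\varepsilon_i(b)=-\infty$ then $\widetilde e_i(b)=\widetilde f_i(b)=0$. **Gelfand-Tsetlin patterns.** A partition is a sequence $\lambda=(\lambda_1\ge\lambda_2\ge\cdots\ge 0)$ of integers with finite sum; its parts are its nonzero entries. A Gelfand-Tsetlin pattern with $n$ rows and top row $\lambda$ is a triangular array $\Lambda=(\lambda^{(i)}_j)_{1\le j\le i\le n}$ of non-negative integers with $\lambda^{(i+1)}_j\ge\lambda^{(i)}_j\ge\lambda^{(i+1)}_{j+1}$ for $1\le j\le i\le n-1$, and $\lambda^{(n)}_i=\lambda_i$ for $1\le i\le n$. By convention $\lambda^{(i)}_j=0$ unless $1\le j\le i\le n$. The set of these patterns is $\mathrm{GTP}(n,\lambda)$. **Diamond numbers and diamond-sums.** For $\Lambda\in\mathrm{GTP}(n,\lambda)$ and $i\in\{1,\dots,n-1\}$ put $$a^{(i)}_j(\Lambda)=\lambda^{(i)}_j-\lambda^{(i-1)}_j+\lambda^{(i)}_{j+1}-\lambda^{(i+1)}_{j+1}\quad(0\le j\le i),$$ $$b^{(i)}_j(\Lambda)=-\lambda^{(i)}_j+\lambda^{(i-1)}_{j-1}-\lambda^{(i)}_{j-1}+\lambda^{(i+1)}_j\quad(1\le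 j\le i+1),$$ $$A^{(i)}_j(\Lambda)=\sum_{k=j}^i a^{(i)}_k(\Lambda)\quad(0\le j\le i),\qquad B^{(i)}_j(\Lambda)=\sum_{k=1}^j b^{(i)}_k(\Lambda)\quad(1\le j\le i+1).$$ **Crystal data on $\mathrm{GTP}(n,\lambda)$.** Let $\Lambda\pm\Delta^{(i)}_j$ denote the array obtained from $\Lambda$ by replacing the entry $\lambda^{(i)}_j$ by $\lambda^{(i)}_j\pm1$. For $\Lambda\in\mathrm{GTP}(n,\lambda)$ and $i\in\{1,\dots,n-1\}$ define $$\mathrm{wt}(\Lambda)=\sum_{j=1}^n\Big(\sum_{k=1}^j\lambda^{(j)}_k-\sum_{k=1}^{j-1}\lambda^{(j-1)}_k\Big)\boldsymbol e_j,$$ $$\varphi_i(\Lambda)=\max\{A^{(i)}_1(\Lambda),\dots,A^{(i)}_i(\Lambda)\},\qquad \varepsilon_i(\Lambda)=\max\{B^{(i)}_1(\Lambda),\dots,B^{(i)}_i(\Lambda)\}.$$ These maxima are always $\ge 0$. - $\widetilde f_i(\Lambda)=\Lambda-\Delta^{(i)}_\ell$ if $\varphi_i(\Lambda)>0$, where $\ell=\max\{j\in\{1,\dots,i\}\mid A^{(i)}_j(\Lambda)=\varphi_i(\Lambda)\}$; and $\widetilde f_i(\Lambda)=0$ if $\varphi_i(\Lambda)=0$. - $\widetilde e_i(\Lambda)=\Lambda+\Delta^{(i)}_\ell$ if $\varepsilon_i(\Lambda)>0$, where $\ell=\min\{j\in\{1,\dots,i\}\mid B^{(i)}_j(\Lambda)=\varepsilon_i(\Lambda)\}$;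 and $\widetilde e_i(\Lambda)=0$ if $\varepsilon_i(\Lambda)=0$. Here $0$ is a formal symbol not belonging to $\mathrm{GTP}(n,\lambda)$. *)

(* Defs.v *)
From HB Require Import structures.
From mathcomp Require Import all_boot all_order all_algebra.
From mathcomp Require Import generic_quotient ring_quotient.

Set Implicit Arguments.
Unset Strict Implicit.
Unset Printing Implicit Defensive.

Import Order.TTheory GRing.Theory Num.Theory.
Local Open Scope ring_scope.
Local Open Scope quotient_scope.

(* I = {1, ..., n - 1}, with its elements used as 1-based naturals. *)
Definition cartan_index (n : nat) : Type := {i : 'I_n | (0 < i)%N}.
Definition cartan_index_val n (i : cartan_index n) : nat := val (val i).
Coercion cartan_index_val : cartan_index >-> nat.

(* P = Z^n / Z (1, ..., 1): the subgroup generated by the relation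
   e_1 + ... + e_n = 0 consists of the constant vectors (const_vecP). *)
Definition const_vec (n : nat) : {pred 'rV[int]_n} :=
  [pred v : 'rV[int]_n | [forall j, forall k, v 0 j == v 0 k]].

Lemma const_vecP n (v : 'rV[int]_n) :
  reflect (exists c : int, v = const_mx 1 *~ c) (v \in @const_vec n).
Proof.
apply: (iffP idP) => [/forallP vE | [c ->]]; last first.
  by apply/forallP => j; apply/forallP => k; rewrite -scaler_int !mxE.
case: n v vE => [|n] v vE; first by exists 0; apply/rowP => - [].
exists (v 0 0); apply/rowP => j; rewrite -scaler_int !mxE intz mulr1.
by have /forallP/(_ 0)/eqP := vE j.
Qed.

Fact const_vec_zmod_closed n : zmod_closed (@const_vec n).
Proof.
split; first by apply/const_vecP; exists 0; rewrite mulr0z.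
move=> u v /const_vecP[c ->] /const_vecP[d ->].
by apply/const_vecP; exists (c - d); rewrite mulrzBr.
Qed.

HB.instance Definition _ n :=
  GRing.isZmodClosed.Build 'rV[int]_n (@const_vec n) (const_vec_zmod_closed n).

Definition weight_lattice (n : nat) := Quotient.quot (@const_vec n).

(* The class of e_j, for 1 <= j <= n. *)
Definition we (n j : nat) : weight_lattice n :=
  \pi_(weight_lattice n) (\row_(k < n) (k.+1 == j)%:R : 'rV[int]_n).

Definition alpha n (i : cartan_index n) : weight_lattice n := we n i - we n i.+1.

Definition coroot_coef (j i : nat) : int := (j == i)%:R - (j == i.+1)%:R.

(* <x, alpha_i^vee>: the Z-linear extension of
   <e_j, alpha_i^vee> = delta_(j,i) - delta_(j,i+1), evaluated on a
   representative of x; see coroot_pi for the independence of the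
   representative. *)
Definition coroot_vec n (i : cartan_index n) (v : 'rV[int]_n) : int :=
  \sum_(k < n) v 0 k * coroot_coef k.+1 i.

Definition coroot n (i : cartan_index n) (x : weight_lattice n) : int :=
  coroot_vec i (repr x).

Lemma coroot_vecB n (i : cartan_index n) : {morph coroot_vec i : u v / u - v}.
Proof.
move=> u v; rewrite /coroot_vec -sumrB; apply: eq_bigr => k _.
by rewrite !mxE mulrBl.
Qed.

Lemma coroot_vec_const n (i : cartan_index n) (v : 'rV[int]_n) :
  v \in @const_vec n -> coroot_vec i v = 0.
Proof.
move=> /const_vecP[c ->]; rewrite /coroot_vec.
under eq_bigr => k _ do rewrite -scaler_int !mxE mulr1.
rewrite -mulr_sumr sumrB; case: i => i i_gt0; rewrite /cartan_index_val /=.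
have i1_lt : (i.-1 < n)%N by apply: leq_ltn_trans (leq_pred i) (ltn_ord i).
rewrite (bigD1 (Ordinal i1_lt)) //= prednK // eqxx big1; last first.
  move=> k; rewrite -val_eqE /= => /negPf k_neq.
  by rewrite -(prednK i_gt0) eqSS k_neq.
rewrite (bigD1 i) //= eqxx big1; first by rewrite subrr mulr0.
by move=> k; rewrite -val_eqE eqSS /= => /negPf ->.
Qed.

Lemma coroot_pi n (i : cartan_index n) (v : 'rV[int]_n) :
  coroot i (\pi_(weight_lattice n) v) = coroot_vec i v.
Proof.
apply/eqP; rewrite -subr_eq0 -coroot_vecB; apply/eqP/coroot_vec_const.
by rewrite Quotient.idealrBE reprK.
Qed.

Fact coroot_zmod_morphism n (i : cartan_index n) : zmod_morphism (coroot i).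
Proof.
move=> x y; rewrite -[x]reprK -[y]reprK.
by rewrite -(raddfB \pi_(weight_lattice n)) !coroot_pi coroot_vecB.
Qed.

HB.instance Definition _ n (i : cartan_index n) :=
  GRing.isZmodMorphism.Build (weight_lattice n) int (coroot i)
    (coroot_zmod_morphism i).

Lemma coroot_we n (i : cartan_index n) (j : nat) :
  (0 < j <= n)%N -> coroot i (we n j) = coroot_coef j i.
Proof.
case: j => //= j j_lt; rewrite coroot_pi /coroot_vec.
rewrite (bigD1 (Ordinal j_lt)) //= mxE eqxx mul1r big1 ?addr0 // => k.
by rewrite mxE -val_eqE /= eqSS => /negPf ->; rewrite mul0r.
Qed.

Lemma sum_we n : \sum_(1 <= j < n.+1) we n j = 0.
Proof.
rewrite /we -raddf_sum -[RHS](raddf0 \pi_(weight_lattice n)).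
apply/eqP; rewrite -Quotient.idealrBE subr0; apply/const_vecP; exists 1.
apply/rowP => k; rewrite mulr1z summxE mxE big_add1 big_mkord.
rewrite (bigD1 k) //= mxE eqxx big1 ?addr0 // => j.
by rewrite mxE -val_eqE eqSS eq_sym /= => /negPf ->.
Qed.

(* Z u {-oo}, with None standing for -oo and (-oo) + k = -oo. *)
Definition add_ninfty (x : option int) (k : int) : option int :=
  omap (fun z => z + k) x.

(* None in the codomain of e and f is the formal symbol 0. *)
Record is_crystal (n : nat) (B : Type)
    (wt : B -> weight_lattice n)
    (e f : cartan_index n -> B -> option B)
    (eps phi : cartan_index n -> B -> option int) : Prop := IsCrystal {
  crystal_nonempty : exists b : B, True;
  crystal_fe : forall i b b', f i b = Some b' <-> Some b = e i b';
  crystal_f_data : forall i b b', f i b = Some b' ->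
    [/\ wt b' = wt b - alpha i,
        eps i b' = add_ninfty (eps i b) 1
      & phi i b' = add_ninfty (phi i b) (- 1)];
  crystal_phi_eps : forall i b,
    phi i b = add_ninfty (eps i b) (coroot i (wt b));
  crystal_ninfty : forall i b, phi i b = None -> eps i b = None ->
    e i b = None /\ f i b = None
}.

(* A sequence (lambda_1, lambda_2, ...) is a function on nat with
   lam j = lambda_(j+1). *)
Definition is_partition (lam : nat -> nat) : Prop :=
  (forall j, (lam j.+1 <= lam j)%N) /\
  (exists M, forall N, (\sum_(j < N) lam j <= M)%N).

Definition at_most_parts (lam : nat -> nat) (n : nat) : Prop :=
  forall s : seq nat, uniq s -> all (fun j => lam j != 0%N) s -> (size s <= n)%N.

(* Positions (i, j), 1 <= j <= i <= n: row i, column j. *)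
Definition tri_index (n : nat) : Type :=
  {p : 'I_n.+1 * 'I_n.+1 | (0 < p.2 <= p.1)%N}.
HB.instance Definition _ n := Finite.on (tri_index n).

Definition tri_row n (p : tri_index n) : nat := (val p).1.
Definition tri_col n (p : tri_index n) : nat := (val p).2.

(* Arbitrary integer entries, so that Lambda +- Delta is always an array. *)
Definition tri_array (n : nat) : Type := {ffun tri_index n -> int}.
HB.instance Definition _ n := Choice.on (tri_array n).

(* lambda^(i)_j, equal to 0 unless 1 <= j <= i <= n. *)
Definition entry n (L : tri_array n) (i j : nat) : int :=
  if [pick p : tri_index n | (tri_row p == i) && (tri_col p == j)] is Some p
  then L p else 0.

Lemma entry_in n (L : tri_array n) (p : tri_index n) :
  entry L (tri_row p) (tri_col p) = L p.
Proof.
rewrite /entry; case: pickP => [q /andP[/eqP rE /eqP cE]|/(_ p)]; last first.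
  by rewrite !eqxx.
congr (L _); apply/val_inj; move: rE cE; rewrite /tri_row /tri_col.
by case: (val q) (val p) => [q1 q2] [p1 p2] /= /val_inj -> /val_inj ->.
Qed.

Lemma entry_out n (L : tri_array n) (i j : nat) :
  ~~ [&& 0 < j, j <= i & i <= n]%N -> entry L i j = 0.
Proof.
rewrite /entry; case: pickP => // p /andP[/eqP <- /eqP <-].
rewrite /tri_row /tri_col; case/andP: (valP p) => -> -> /=.
by rewrite -ltnS ltn_ord.
Qed.

Definition is_gtp n (lam : nat -> nat) (L : tri_array n) : bool :=
  [&& [forall p, 0 <= L p],
      [forall i : 'I_n, forall j : 'I_n, (0 < j <= i)%N ==>
         (entry L i.+1 j.+1 <= entry L i j <= entry L i.+1 j)]
    & [forall j : 'I_n, entry L n j.+1 == (lam j)%:Z]].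

Record GTP (n : nat) (lam : nat -> nat) := MkGTP {
  gtp_array :> tri_array n;
  _ : is_gtp lam gtp_array
}.
HB.instance Definition _ n lam := [isSub for @gtp_array n lam].
HB.instance Definition _ n lam := [Choice of GTP n lam by <:].

(* Only used with 1 <= i, and 1 <= j in diamond_b, so that the truncated
   predecessors below are exact. *)
Definition diamond_a n (L : tri_array n) (i j : nat) : int :=
  entry L i j - entry L i.-1 j + entry L i j.+1 - entry L i.+1 j.+1.

Definition diamond_b n (L : tri_array n) (i j : nat) : int :=
  - entry L i j + entry L i.-1 j.-1 - entry L i j.-1 + entry L i.+1 j.

Definition diamond_A n (L : tri_array n) (i j : nat) : int :=
  \sum_(j <= k < i.+1) diamond_a L i k.

Definition diamond_B n (L : tri_array n) (i j : nat) : int :=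
  \sum_(1 <= k < j.+1) diamond_b L i k.

Definition gt_wt n (L : tri_array n) : weight_lattice n :=
  \sum_(1 <= j < n.+1)
    we n j *~ (\sum_(1 <= k < j.+1) entry L j k
               - \sum_(1 <= k < j) entry L j.-1 k).

(* For i >= 1 the neutral value A_1 (resp. B_1) is one of the terms, so these
   are the maxima of the nonempty families A_1, ..., A_i and B_1, ..., B_i. *)
Definition gt_phi n (i : nat) (L : tri_array n) : int :=
  \big[Num.max/diamond_A L i 1]_(1 <= j < i.+1) diamond_A L i j.

Definition gt_eps n (i : nat) (L : tri_array n) : int :=
  \big[Num.max/diamond_B L i 1]_(1 <= j < i.+1) diamond_B L i j.

(* Lambda + d Delta^(i)_j *)
Definition tri_shift n (L : tri_array n) (i j : nat) (d : int) : tri_array n :=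
  [ffun p => if (tri_row p == i) && (tri_col p == j) then L p + d else L p].

Definition f_pos n (i : nat) (L : tri_array n) : nat :=
  \max_(1 <= j < i.+1 | diamond_A L i j == gt_phi i L) j.

(* The neutral value i is an upper bound of the range, so this is the minimum
   of the (nonempty) set of indices. *)
Definition e_pos n (i : nat) (L : tri_array n) : nat :=
  \big[minn/i]_(1 <= j < i.+1 | diamond_B L i j == gt_eps i L) j.

Definition gt_f n (i : nat) (L : tri_array n) : option (tri_array n) :=
  if 0 < gt_phi i L then Some (tri_shift L i (f_pos i L) (- 1)) else None.

Definition gt_e n (i : nat) (L : tri_array n) : option (tri_array n) :=
  if 0 < gt_eps i L then Some (tri_shift L i (e_pos i L) 1) else None.

(* Main.v *)
Require Import Defs.
From mathcomp Require Import all_boot all_order all_algebra.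
From mathcomp Require Import zify.

Set Implicit Arguments.
Unset Strict Implicit.
Unset Printing Implicit Defensive.

Import Order.TTheory GRing.Theory Num.Theory.
Local Open Scope ring_scope.

(** Fix a row i and write x, y, z for the rows i, i - 1, i + 1. The proof rests
    on the identity b_(j+1) = - a_j, which gives B_j = A_j - A_0: both
    operators are governed by the single sequence A_1, ..., A_i. The operator
    f_i lowers x_l at the last index l where A is maximal, and e_i raises x_l
    at the first such index.

    Adding d to x_l adds d to a_l and to a_(l-1), hence adds d to A_l and 2d
    to A_j for j < l, while A_j with j > l does not move
    ([diamond_A_shift]). For d = - 1 this turns the conditions saying that l
    is the last maximum exactly into those saying that l is the first maximum
    of the new sequence ([argmax_shift]). So e_i undoes f_i and conversely;
    the maximum phi_i drops by 1, and as A_0 drops by 2, the number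
    eps_i = phi_i - A_0 grows by 1.

    The results of the operators are patterns because of the strict sign of a
    single diamond number. At the last maximum, when it is positive,
    a_l = A_l - A_(l+1) > 0, where A_(i+1) = 0. Since x_(l+1) <= z_(l+1) and
    x_(l+1) <= y_l, this forces x_l > y_l and x_l > z_(l+1), which is all that
    lowering x_l needs ([shift_down_gtp]); dually b_l > 0 allows raising x_l
    ([shift_up_gtp]).

    Finally A_0 is the sum of all a_j, that is twice the sum of row i minus
    the sums of its two neighbours, and this is the pairing of the weight with
    the i-th coroot ([coroot_gt_wt]); so eps_i = phi_i - A_0 is the crystal
    axiom relating phi_i, eps_i and the weight. *)

(** * First and last maxima of a finite sequence *)

(** The strict inequality on one side of l is written as a weak inequality with
    an integer correction, so that the effect of a shift on all the conditions
    is linear arithmetic. *)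
Definition last_argmax (F : nat -> int) (i l : nat) : Prop :=
  (0 < l <= i)%N /\
  forall j, (0 < j <= i)%N -> F j + ((l < j)%N : nat)%:Z <= F l.

Definition first_argmax (F : nat -> int) (i l : nat) : Prop :=
  (0 < l <= i)%N /\
  forall j, (0 < j <= i)%N -> F j + ((j < l)%N : nat)%:Z <= F l.

Lemma bigmax_nat_eq (F : nat -> int) (i l : nat) :
  (0 < l <= i)%N -> (forall j, (0 < j <= i)%N -> F j <= F l) ->
  \big[Num.max/F 1%N]_(1 <= j < i.+1) F j = F l.
Proof.
move=> l_in F_le; apply/le_anti/andP; split.
  rewrite big_seq; apply: bigmax_le => [|j]; first by apply: F_le; lia.
  by rewrite mem_index_iota => j_in; apply: F_le; lia.
by apply: (@le_bigmax_seq _ _ _ _ _ l xpredT F); rewrite ?mem_index_iota //; lia.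
Qed.

Lemma last_argmax_exists (F : nat -> int) (i : nat) :
  (0 < i)%N -> exists l, last_argmax F i l.
Proof.
elim: i => // -[_ _|i /(_ isT)[l [l_in l_max]] _].
  by exists 1%N; split=> // j j_in; have -> : j = 1%N; lia.
have [Fl|Fl] := leP (F l) (F i.+2).
  exists i.+2; split=> // [|j j_in]; first by lia.
  by have [->|j_neq] := eqVneq j i.+2; [lia | have := l_max j; lia].
exists l; split=> [|j j_in]; first by lia.
by have [->|j_neq] := eqVneq j i.+2; [lia | have := l_max j; lia].
Qed.

Lemma first_argmax_exists (F : nat -> int) (i : nat) :
  (0 < i)%N -> exists l, first_argmax F i l.
Proof.
move=> i_gt0; have [l [l_in l_max]] := last_argmax_exists (fun j => F (i.+1 - j)%N) i_gt0.
(* The reversal j |-> i + 1 - j of {1, ..., i} exchanges last and first. *)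
exists (i.+1 - l)%N; split=> [|j j_in]; first by lia.
have := l_max (i.+1 - j)%N; have -> : (i.+1 - (i.+1 - j))%N = j by lia.
lia.
Qed.

(** On nat, minn has no neutral element, so the theory of commutative monoid
    big operators does not apply to the minimum defining [e_pos]. *)
Lemma bigminn_le (r : seq nat) (P : pred nat) (m l : nat) :
  l \in r -> P l -> (\big[minn/m]_(j <- r | P j) j <= l)%N.
Proof.
move=> + Pl; elim: r => // j r IHr; rewrite inE big_cons.
case/predU1P => [<-|/IHr r_le]; first by rewrite Pl geq_minl.
by case: ifP => // _; apply: leq_trans (geq_minr _ _) r_le.
Qed.

(** * The operators through maxima of diamond-sums *)

Section Array.

Variables (n : nat).
Implicit Types (L : tri_array n) (i j k l : nat) (d : int).

Lemma phi_last_argmax L i l :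
  last_argmax (diamond_A L i) i l -> gt_phi i L = diamond_A L i l.
Proof.
move=> [l_in l_max]; apply: bigmax_nat_eq => // j j_in.
by have := l_max j j_in; lia.
Qed.

Lemma f_pos_last_argmax L i l :
  last_argmax (diamond_A L i) i l -> f_pos i L = l.
Proof.
move=> lP; rewrite /f_pos (phi_last_argmax lP); case: lP => l_in l_max.
apply/eqP; rewrite eqn_leq; apply/andP; split.
  rewrite big_seq_cond; apply/bigmax_leqP_seq => j; rewrite mem_index_iota.
  move=> _ /andP[j_in /eqP Aj]; have := l_max j; lia.
by apply: (@leq_bigmax_seq _ _ _ (fun j => j)); rewrite ?mem_index_iota //; lia.
Qed.

Lemma eps_first_argmax L i l :
  first_argmax (diamond_B L i) i l -> gt_eps i L = diamond_B L i l.
Proof.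
move=> [l_in l_max]; apply: bigmax_nat_eq => // j j_in.
by have := l_max j j_in; lia.
Qed.

Lemma e_pos_first_argmax L i l :
  first_argmax (diamond_B L i) i l -> e_pos i L = l.
Proof.
move=> lP; rewrite /e_pos (eps_first_argmax lP); case: lP => l_in l_max.
apply/eqP; rewrite eqn_leq; apply/andP; split.
  by apply: bigminn_le; rewrite ?mem_index_iota //; lia.
rewrite big_seq_cond; elim/big_ind: _ => [|x y lx ly|j]; [lia|lia|].
rewrite mem_index_iota => /andP[j_in /eqP Bj]; have := l_max j; lia.
Qed.

(** * The effect of a shift on diamond-sums *)

Lemma entry_shift L i l d j k : (0 < l <= i)%N -> (i <= n)%N ->
  entry (tri_shift L i l d) j k =
  entry L j k + (if (j == i) && (k == l) then d else 0).
Proof.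
move=> l_in i_le; rewrite /entry; case: pickP => [p /andP[/eqP <- /eqP <-]|none].
  by rewrite ffunE; case: ifP; rewrite ?addr0.
case: ifP => [/andP[/eqP jE /eqP kE]|]; rewrite ?addr0 //.
have i_lt : (i < n.+1)%N by lia.
have l_lt : (l < n.+1)%N by lia.
pose p : tri_index n := Sub (Ordinal i_lt, Ordinal l_lt) l_in.
by have := none p; rewrite /tri_row /tri_col /= jE kE !eqxx.
Qed.

Lemma shiftK L i l d : tri_shift (tri_shift L i l d) i l (- d) = L.
Proof.
by apply/ffunP => p; rewrite !ffunE; case: (_ && _); rewrite ?addrK.
Qed.

Lemma entry0 L i : entry L i 0 = 0.
Proof. by rewrite entry_out. Qed.

Lemma entry_gt L i j : (i < j)%N -> entry L i j = 0.
Proof. by move=> ij; rewrite entry_out //; lia. Qed.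

Lemma diamond_bS L i j : diamond_b L i j.+1 = - diamond_a L i j.
Proof. by rewrite /diamond_b /diamond_a /=; lia. Qed.

Lemma diamond_A_recl L i j : (j <= i)%N ->
  diamond_A L i j = diamond_a L i j + diamond_A L i j.+1.
Proof. by move=> ji; rewrite /diamond_A big_ltn. Qed.

Lemma diamond_A_gt L i : diamond_A L i i.+1 = 0.
Proof. by rewrite /diamond_A big_geq. Qed.

(** Telescoped form of b_(j+1) = - a_j: A_j - A_0 is minus the sum of
    a_0, ..., a_(j-1). *)
Lemma diamond_B_A L i j : (j <= i)%N ->
  diamond_B L i j = diamond_A L i j - diamond_A L i 0.
Proof.
elim: j => [|j IHj] ji; first by rewrite /diamond_B big_geq // subrr.
rewrite /diamond_B big_nat_recr //= -/(diamond_B L i j) IHj 1?ltnW //.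
by rewrite diamond_bS (@diamond_A_recl _ _ j) 1?ltnW //; lia.
Qed.

Lemma first_argmax_A_B L i l :
  first_argmax (diamond_B L i) i l <-> first_argmax (diamond_A L i) i l.
Proof.
split=> -[l_in l_max]; split=> // j j_in; have := l_max j j_in;
  rewrite !diamond_B_A; lia.
Qed.

Lemma diamond_a_shift L i l d j : (0 < l <= i)%N -> (i <= n)%N ->
  diamond_a (tri_shift L i l d) i j =
  diamond_a L i j + (if j == l then d else 0) + (if j.+1 == l then d else 0).
Proof.
move=> l_in i_le; rewrite /diamond_a !entry_shift //.
have -> : (i.-1 == i) = false by lia.
have -> : (i.+1 == i) = false by lia.
by rewrite eqxx /=; lia.
Qed.

(** The two corrections come from a_l and a_(l-1), the only two diamond numbers
    of row i that involve the shifted entry. *)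
Lemma diamond_A_shift L i l d j :
  (0 < l <= i)%N -> (i <= n)%N -> (j <= i.+1)%N ->
  diamond_A (tri_shift L i l d) i j =
  diamond_A L i j + (if (j <= l)%N then d else 0) + (if (j < l)%N then d else 0).
Proof.
move=> l_in i_le; move m_eq: (i.+1 - j)%N => m.
elim: m j m_eq => [|m IHm] j m_eq j_le.
  have -> : j = i.+1 by lia.
  by rewrite !diamond_A_gt !ifF //; lia.
rewrite !(@diamond_A_recl _ _ j) ?diamond_a_shift ?IHm //; try by lia.
by repeat case: ifP => ?; lia.
Qed.

(** The heart of the proof. After lowering at l, the sequence is A_j - 2 before
    l, A_l - 1 at l, and A_j after l. Hence A_j <= A_l before l becomes a
    strict inequality, and A_j < A_l after l becomes a weak one. *)
Lemma argmax_shift L i l : (i <= n)%N ->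
  last_argmax (diamond_A L i) i l <->
  first_argmax (diamond_A (tri_shift L i l (- 1)) i) i l.
Proof.
move=> i_le; split=> -[l_in l_max]; split=> // j j_in; have := l_max j j_in;
  rewrite !diamond_A_shift //; try lia; repeat case: ifP => ?; lia.
Qed.

(** Since B_j = A_j - A_0 for all j, the maxima differ by A_0 as well. *)
Lemma phi_eps L i : (0 < i)%N -> gt_phi i L = gt_eps i L + diamond_A L i 0.
Proof.
move=> i_gt0; have [l lP] := last_argmax_exists (diamond_A L i) i_gt0.
have [m mP] := first_argmax_exists (diamond_B L i) i_gt0.
rewrite (phi_last_argmax lP) (eps_first_argmax mP).
case: lP => l_in l_max; have /first_argmax_A_B[m_in m_max] := mP.
rewrite diamond_B_A; last by lia.
by have := l_max m m_in; have := m_max l l_in; lia.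
Qed.

(** * The weight *)

Definition row_sum L i : int := \sum_(1 <= k < i.+1) entry L i k.

Lemma gt_wtE L :
  gt_wt L = \sum_(1 <= j < n.+1) we n j *~ (row_sum L j - row_sum L j.-1).
Proof.
by apply: eq_big_nat => j /andP[j_gt0 _]; rewrite /row_sum prednK.
Qed.

(** Every entry of row i occurs in two of the a_j, every entry of the adjacent
    rows in one. *)
Lemma diamond_A0 L i : (0 < i)%N ->
  diamond_A L i 0 = row_sum L i - row_sum L i.-1 - (row_sum L i.+1 - row_sum L i).
Proof.
move=> i_gt0; rewrite /diamond_A /diamond_a sumrB big_split /= sumrB.
have shift G : \sum_(0 <= k < i.+1) G k.+1 = \sum_(1 <= k < i.+2) G k :> int.
  by rewrite [RHS]big_add1.
rewrite (shift (entry L i)) (shift (entry L i.+1)) /row_sum.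
rewrite big_ltn // entry0 [X in _ - X + _]big_ltn // entry0.
rewrite (prednK i_gt0) [X in _ - (_ + X) + _]big_nat_recr //= [entry L i.-1 i]entry_gt; last by lia.
rewrite [X in _ + X - _]big_nat_recr //= [entry L i i.+1]entry_gt //.
by rewrite !(add0r, addr0) opprB addrA.
Qed.

Lemma row_sum_shift L i l d j : (0 < l <= i)%N -> (i <= n)%N ->
  row_sum (tri_shift L i l d) j = row_sum L j + (if j == i then d else 0).
Proof.
move=> l_in i_le; rewrite /row_sum.
under eq_bigr => k _ do rewrite entry_shift //.
rewrite big_split /=; congr (_ + _); have [->|_] /= := eqVneq j i; last exact: big1.
rewrite -big_mkcond big_nat1_eq; case: ifP => //; lia.
Qed.

Lemma coroot_gt_wt (i : cartan_index n) L :
  coroot i (gt_wt L) = diamond_A L i 0.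
Proof.
have i_gt0 : (0 < i)%N := valP i.
have i_lt : (i < n)%N := ltn_ord (val i).
rewrite gt_wtE diamond_A0 // raddf_sum /=.
under eq_big_nat => j j_in.
  rewrite raddfMz /= coroot_we; last by lia.
  have -> : coroot_coef j i *~ (row_sum L j - row_sum L j.-1) =
      (if j == i then row_sum L j - row_sum L j.-1 else 0) -
      (if j == i.+1 then row_sum L j - row_sum L j.-1 else 0).
    rewrite /coroot_coef mulrzz; have [->|_] := eqVneq j i.
      have -> : (i == i.+1 :> nat) = false by lia.
      by rewrite !subr0 mul1r.
    by case: (j == i.+1); rewrite !sub0r ?oppr0 ?mul0r // mulN1r.
  over.
rewrite sumrB -!big_mkcond !big_nat1_eq.
by rewrite !ifT //; lia.
Qed.

(** Lowering one entry of row i lowers the coefficient of e_i, which is the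
    sum of row i minus that of row i - 1, and raises that of e_(i+1). *)
Lemma gt_wt_shift (i : cartan_index n) l L : (0 < l <= i)%N ->
  gt_wt (tri_shift L i l (- 1)) = gt_wt L - alpha i.
Proof.
move=> l_in; have i_lt : (i < n)%N := ltn_ord (val i).
apply/eqP; rewrite addrC -subr_eq; apply/eqP; rewrite !gt_wtE -sumrB.
under eq_big_nat => j j_in.
  rewrite !(row_sum_shift _ _ _ l_in (ltnW i_lt)) -(mulrzBr (we n j)).
  have -> : row_sum L j + (if j == i then -1 else 0)
      - (row_sum L j.-1 + (if j.-1 == i then -1 else 0))
      - (row_sum L j - row_sum L j.-1) =
      (if j == i.+1 then 1 else 0) - (if j == i then 1 else 0).
    have -> : (j.-1 == i) = (j == i.+1) by lia.
    by repeat case: ifP => ?; lia.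
  rewrite mulrzBr !(fun_if (fun z => we n j *~ z)) mulr0z mulr1z.
  over.
rewrite sumrB -!big_mkcond !big_nat1_eq !ifT; [|lia|lia].
by rewrite opprB.
Qed.

Lemma gt_f_wt (i : cartan_index n) L L' :
  gt_f i L = Some L' -> gt_wt L' = gt_wt L - alpha i.
Proof.
have i_gt0 : (0 < i)%N := valP i.
rewrite /gt_f; case: ifP => // _ [<-]; apply: gt_wt_shift.
have [l lP] := last_argmax_exists (diamond_A L i) i_gt0.
by rewrite (f_pos_last_argmax lP); case: lP.
Qed.

(** * Stability of the set of patterns *)

(** Because entries outside the triangle are 0, the interlacing inequalities
    between nonnegative entries extend to all columns j, except for the first
    one at j = 0. This removes the boundary cases from the two lemmas below. *)
Lemma gtpP (lam : nat -> nat) L :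
  reflect [/\ forall i j, 0 <= entry L i j,
              forall i j, (i < n)%N -> (0 < j)%N -> entry L i.+1 j.+1 <= entry L i j,
              forall i j, (i < n)%N -> entry L i j <= entry L i.+1 j
            & forall j, (j < n)%N -> entry L n j.+1 = (lam j)%:Z]
          (is_gtp lam L).
Proof.
apply: (iffP and3P) => [[/forallP L_ge0 /forallP ilc /forallP top]|
                        [L_ge0 ilc1 ilc2 top]]; last first.
  split; apply/forallP; first by move=> p; rewrite -entry_in.
    by move=> i; apply/forallP => j; apply/implyP => /andP[j_gt0 _]; rewrite ilc1 ?ilc2.
  by move=> j; rewrite top.
have E_ge0 i j : 0 <= entry L i j by rewrite /entry; case: pickP.
have {}ilc i j : (0 < j <= i)%N -> (i < n)%N ->
    entry L i.+1 j.+1 <= entry L i j <= entry L i.+1 j.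
  move=> j_in i_lt; have j_lt : (j < n)%N by lia.
  have /forallP/(_ (Ordinal j_lt))/implyP := ilc (Ordinal i_lt).
  by apply.
split=> // [i j i_lt j_gt0|i j i_lt|j j_lt].
- have [ji|ij] := leqP j i; first by have /andP[] := ilc i j (introT andP (conj j_gt0 ji)) i_lt.
  by rewrite entry_gt.
- have [j_in|j_out] := boolP (0 < j <= i)%N; first by have /andP[] := ilc i j j_in i_lt.
  by rewrite entry_out //; lia.
- exact/eqP/(top (Ordinal j_lt)).
Qed.

(** Each of the two inequalities x_l > y_l and x_l > z_(l+1) follows from
    a_l > 0 by bounding x_(l+1) by the other of z_(l+1) and y_l. *)
Lemma shift_down_gtp (lam : nat -> nat) L i l :
  (i < n)%N -> is_gtp lam L -> (0 < l <= i)%N -> 0 < diamond_a L i l ->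
  is_gtp lam (tri_shift L i l (- 1)).
Proof.
move=> i_lt /gtpP[L_ge0 ilc1 ilc2 top] l_in a_gt0.
have i1_lt : (i.-1 < n)%N by lia.
have l_gt0 : (0 < l)%N by lia.
have := ilc1 i.-1 l i1_lt l_gt0; have := ilc2 i l.+1 i_lt.
have := ilc1 i l i_lt l_gt0; have := ilc2 i.-1 l i1_lt.
have := L_ge0 i.+1 l.+1; move: a_gt0; rewrite /diamond_a prednK; last by lia.
move=> a_gt0 z_ge0 yx zx xz xy.
apply/gtpP; split=> [j k|j k j_lt k_gt0|j k j_lt|k k_lt];
  rewrite !(entry_shift _ _ _ _ l_in (ltnW i_lt)).
- have := L_ge0 j k; case: ifP => [/andP[/eqP -> /eqP ->]|_]; lia.
- have := ilc1 j k j_lt k_gt0; case: ifP => ?; case: ifP => [/andP[/eqP -> /eqP ->]|_]; lia.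
- have := ilc2 j k j_lt; case: ifP => ?; case: ifP => [/andP[/eqP ji /eqP ->]|_]; try lia.
  by move: a_gt0 xz; rewrite -ji /=; lia.
- by rewrite ifF ?addr0 ?top //; lia.
Qed.

(** Dual of [shift_down_gtp]: b_l = y_(l-1) + z_l - x_l - x_(l-1) > 0 together
    with x_(l-1) >= y_(l-1) and x_(l-1) >= z_l gives x_l < z_l and
    x_l < y_(l-1). For l = 1 only z_1 bounds x_1, and b_1 = z_1 - x_1. *)
Lemma shift_up_gtp (lam : nat -> nat) L i l :
  (i < n)%N -> is_gtp lam L -> (0 < l <= i)%N -> 0 < diamond_b L i l ->
  is_gtp lam (tri_shift L i l 1).
Proof.
case: l => // l i_lt /gtpP[L_ge0 ilc1 ilc2 top] l_in b_gt0.
have i1_lt : (i.-1 < n)%N by lia.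
have := ilc1 i l i_lt; have := ilc2 i.-1 l i1_lt.
move: b_gt0; rewrite /diamond_b /= prednK; last by lia.
move=> b_gt0 yx zx.
apply/gtpP; split=> [j k|j k j_lt k_gt0|j k j_lt|k k_lt];
  rewrite !(entry_shift _ _ _ _ l_in (ltnW i_lt)).
- have := L_ge0 j k; case: ifP => [/andP[/eqP -> /eqP ->]|_]; lia.
- have := ilc1 j k j_lt k_gt0; case: ifP => [/andP[/eqP ji /eqP kl]|_]; last by case: ifP; lia.
  case: ifP => [|_]; first lia.
  have jE : j = i.-1 by lia.
  have kE : k = l by lia.
  by move: zx; rewrite ji kl jE kE (_ : 0 < l)%N //; lia.
- have := ilc2 j k j_lt; case: ifP => [/andP[/eqP ji /eqP kl]|_]; last by case: ifP; lia.
  case: ifP => [|_]; first lia.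
  move: zx yx; rewrite ji kl; case: (posnP l) => [l0|l_gt0]; last lia.
  move: b_gt0; rewrite l0 !entry0; lia.
- by rewrite ifF ?addr0 ?top //; lia.
Qed.

(** * The crystal operators on patterns *)

(** The term A_i = a_i = x_i - z_(i+1) is nonnegative by interlacing. *)
Lemma gt_phi_ge0 (lam : nat -> nat) L i :
  (0 < i < n)%N -> is_gtp lam L -> 0 <= gt_phi i L.
Proof.
move=> i_in /gtpP[_ ilc _ _]; have i_gt0 : (0 < i)%N by lia.
have [l lP] := last_argmax_exists (diamond_A L i) i_gt0.
rewrite (phi_last_argmax lP); case: lP => l_in /(_ i); rewrite i_gt0 leqnn.
rewrite (@diamond_A_recl L i i) // diamond_A_gt /diamond_a.
rewrite (@entry_gt L i i.+1) // (@entry_gt L i.-1 i); last by lia.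
have := ilc i i; lia.
Qed.

(** The term B_1 = b_1 = z_1 - x_1 is nonnegative by interlacing. *)
Lemma gt_eps_ge0 (lam : nat -> nat) L i :
  (0 < i < n)%N -> is_gtp lam L -> 0 <= gt_eps i L.
Proof.
move=> i_in /gtpP[_ _ ilc _]; have i_gt0 : (0 < i)%N by lia.
have [l lP] := first_argmax_exists (diamond_B L i) i_gt0.
rewrite (eps_first_argmax lP); case: lP => l_in /(_ 1%N); rewrite i_gt0.
rewrite {1}/diamond_B big_nat1 /diamond_b !entry0.
have := ilc i 1%N; lia.
Qed.

Lemma gt_f_gtp (lam : nat -> nat) L L' i :
  (0 < i < n)%N -> is_gtp lam L -> gt_f i L = Some L' -> is_gtp lam L'.
Proof.
move=> /andP[i_gt0 i_lt] L_gtp; rewrite /gt_f; case: ifP => // + [<-].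
have [l lP] := last_argmax_exists (diamond_A L i) i_gt0.
rewrite (phi_last_argmax lP) (f_pos_last_argmax lP).
case: lP => l_in l_max A_gt0; apply: shift_down_gtp => //.
have -> : diamond_a L i l = diamond_A L i l - diamond_A L i l.+1.
  by rewrite (@diamond_A_recl L i l) ?addrK //; lia.
(* The convention A_(i+1) = 0 makes phi_i > 0 the strict drop after l = i. *)
have [l_eq|l_neq] := eqVneq l i; first by rewrite {2}l_eq diamond_A_gt subr0.
by have := l_max l.+1; rewrite ltnSn; lia.
Qed.

Lemma gt_e_gtp (lam : nat -> nat) L L' i :
  (0 < i < n)%N -> is_gtp lam L -> gt_e i L = Some L' -> is_gtp lam L'.
Proof.
move=> /andP[i_gt0 i_lt] L_gtp; rewrite /gt_e; case: ifP => // + [<-].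
have [l lP] := first_argmax_exists (diamond_B L i) i_gt0.
rewrite (eps_first_argmax lP) (e_pos_first_argmax lP).
case: lP => l_in l_max B_gt0; apply: shift_up_gtp => //.
have -> : diamond_b L i l = diamond_B L i l - diamond_B L i l.-1.
  rewrite -{2 3}(prednK (n := l)); last by lia.
  by rewrite /diamond_B big_nat_recr //= addrAC subrr add0r prednK //; lia.
(* Likewise the empty sum B_0 = 0 provides the strict rise before l = 1. *)
have [l_eq|l_neq] := eqVneq l 1%N; first by rewrite l_eq /= {2}/diamond_B big_geq // subr0 -l_eq.
by have := l_max l.-1; lia.
Qed.

(** The first maximum of B for the image is the index at which f_i acted, so
    e_i acts there too; it does act, since its eps_i is at least 1. *)
Lemma gt_f_data (lam : nat -> nat) L L' i :
  (0 < i < n)%N -> is_gtp lam L -> gt_f i L = Some L' ->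
  [/\ gt_e i L' = Some L, gt_eps i L' = gt_eps i L + 1
    & gt_phi i L' = gt_phi i L - 1].
Proof.
move=> i_in L_gtp; have /andP[i_gt0 i_lt] := i_in.
have := gt_eps_ge0 i_in L_gtp; rewrite /gt_f; case: ifP => // + + [<-].
have [l lP] := last_argmax_exists (diamond_A L i) i_gt0.
have phiE := phi_last_argmax lP; rewrite (f_pos_last_argmax lP).
have /first_argmax_A_B lP' := (argmax_shift L l (ltnW i_lt)).1 lP.
have l_in := lP.1; have epsE := eps_first_argmax lP'.
have := phi_eps L i_gt0; have := phi_eps (tri_shift L i l (- 1)) i_gt0.
move: epsE; rewrite diamond_B_A; last by lia.
rewrite !(diamond_A_shift _ _ l_in (ltnW i_lt)); [|lia|lia].
have l_gt0 : (0 < l)%N by lia.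
rewrite leqnn ltnn leq0n l_gt0.
rewrite -phiE => epsE phi' phi phi_gt0 eps_ge0.
have eps' : gt_eps i (tri_shift L i l (- 1)) = gt_eps i L + 1 by lia.
split; [|exact: eps'|lia].
by rewrite /gt_e eps' ifT ?(e_pos_first_argmax lP') ?shiftK //; lia.
Qed.

(** The same equivalence [argmax_shift] read backwards: lowering the raised
    pattern at l gives back a sequence whose first maximum is l, so l is the
    last maximum of the raised one. *)
Lemma gt_e_f (lam : nat -> nat) L L' i :
  (0 < i < n)%N -> is_gtp lam L' -> gt_e i L' = Some L -> gt_f i L = Some L'.
Proof.
move=> i_in L_gtp; have /andP[i_gt0 i_lt] := i_in.
have := gt_phi_ge0 i_in L_gtp; rewrite /gt_e; case: ifP => // + + [<-].
have [l lP] := first_argmax_exists (diamond_B L' i) i_gt0.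
rewrite (e_pos_first_argmax lP) => eps_gt0 phi_ge0.
have l_in := lP.1; have L'E := shiftK L' i l 1.
have lP' : last_argmax (diamond_A (tri_shift L' i l 1) i) i l.
  by apply/argmax_shift; [exact: ltnW | rewrite L'E; apply/first_argmax_A_B].
have phi' := phi_last_argmax lP'.
have phiE := phi_eps L' i_gt0; have epsE := eps_first_argmax lP.
move: phi'; rewrite (diamond_A_shift _ _ l_in (ltnW i_lt)); last by lia.
move: epsE; rewrite diamond_B_A; last by lia.
rewrite leqnn ltnn => epsE phi'.
by rewrite /gt_f ifT ?(f_pos_last_argmax lP') ?L'E //; lia.
Qed.

End Array.

(** The pattern whose columns are constant: every row is a truncation of
    lam. *)
Lemma gtp_inhabited (n : nat) (lam : nat -> nat) :
  (forall j, (lam j.+1 <= lam j)%N) ->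
  is_gtp lam ([ffun p => (lam (tri_col p).-1)%:Z] : tri_array n).
Proof.
move=> lam_dec; set L : tri_array n := finfun _.
have EL i j : (0 < j <= i)%N -> (i <= n)%N -> entry L i j = (lam j.-1)%:Z.
  move=> j_in i_le.
  have i_lt : (i < n.+1)%N by lia.
  have j_lt : (j < n.+1)%N by lia.
  pose p : tri_index n := Sub (Ordinal i_lt, Ordinal j_lt) j_in.
  by have -> : entry L i j = L p := entry_in L p; rewrite ffunE.
apply/and3P; split; apply/forallP.
- by move=> p; rewrite ffunE.
- move=> i; apply/forallP => j; apply/implyP => /andP[j_gt0 ji].
  have i_lt := ltn_ord i; rewrite !EL /=; try lia.
  by rewrite !lez_nat leqnn -{1}(prednK j_gt0) lam_dec.
- by move=> j; have j_lt := ltn_ord j; rewrite EL //; lia.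
Qed.

(** An operator on arrays, cut down to patterns; where it would leave the set
    of patterns the value is None, and [gtp_liftE] shows that under stability
    this never happens. *)
Definition gtp_lift (n : nat) (lam : nat -> nat)
    (op : tri_array n -> option (tri_array n)) (L : GTP n lam) :
    option (GTP n lam) :=
  obind insub (op (gtp_array L)).

Lemma gtp_liftE (n : nat) (lam : nat -> nat)
    (op : tri_array n -> option (tri_array n)) (L : GTP n lam) :
  (forall L', op (gtp_array L) = Some L' -> is_gtp lam L') ->
  omap (@gtp_array n lam) (gtp_lift op L) = op (gtp_array L).
Proof.
rewrite /gtp_lift; case: (op _) => //= L' /(_ L' erefl) L'_gtp.
by rewrite (insubT (is_gtp lam) L'_gtp).
Qed.

Lemma omap_gtp_some (n : nat) (lam : nat -> nat) (x : option (GTP n lam)) L :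
  omap (@gtp_array n lam) x = Some (gtp_array L) <-> x = Some L.
Proof. by split=> [|->] //; case: x => //= y [/val_inj ->]. Qed.

Theorem theorem3p3 (n : nat) (lam : nat -> nat) (n_gt0 : (0 < n)%N)
    (lam_part : is_partition lam) (lam_parts : at_most_parts lam n) :
  exists e f : cartan_index n -> GTP n lam -> option (GTP n lam),
    (forall (i : cartan_index n) (L : GTP n lam),
       omap (@gtp_array n lam) (e i L) = gt_e i (gtp_array L)) /\
    (forall (i : cartan_index n) (L : GTP n lam),
       omap (@gtp_array n lam) (f i L) = gt_f i (gtp_array L)) /\
    is_crystal (fun L : GTP n lam => gt_wt (gtp_array L)) e f
      (fun (i : cartan_index n) (L : GTP n lam) => Some (gt_eps i (gtp_array L)))
      (fun (i : cartan_index n) (L : GTP n lam) => Some (gt_phi i (gtp_array L))).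
Proof.
have i_in (i : cartan_index n) : (0 < i < n)%N.
  by apply/andP; split; [exact: (valP i) | exact: ltn_ord (val i)].
pose e (i : cartan_index n) := @gtp_lift n lam (gt_e i).
pose f (i : cartan_index n) := @gtp_lift n lam (gt_f i).
have eE i L : omap (@gtp_array n lam) (e i L) = gt_e i (gtp_array L).
  by apply: gtp_liftE => L'; apply: gt_e_gtp (i_in i) (valP L).
have fE i L : omap (@gtp_array n lam) (f i L) = gt_f i (gtp_array L).
  by apply: gtp_liftE => L'; apply: gt_f_gtp (i_in i) (valP L).
exists e, f; split=> //; split=> //; split.
- by case: lam_part => /gtp_inhabited L_gtp _; exists (MkGTP (L_gtp n)).
- move=> i b b'; split=> [|/esym] /omap_gtp_some; rewrite ?fE ?eE => be.
    by apply/esym/omap_gtp_some; rewrite eE; case: (gt_f_data (i_in i) (valP b) be).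
  by apply/omap_gtp_some; rewrite fE; apply: gt_e_f (i_in i) (valP b') be.
- move=> i b b' /omap_gtp_some; rewrite fE => bf.
  have [_ /= -> ->] := gt_f_data (i_in i) (valP b) bf; split=> //.
  exact: gt_f_wt bf.
- move=> i b; rewrite /= coroot_gt_wt phi_eps //.
  by have /andP[] := i_in i.
- by [].
Qed.
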